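(* Let $(G,+)$ be a group (not necessarily abelian) with identity $0_G$, let $R$ be a reflexive relation on $G$, and let $A,B$ be nonempty subsets of $G$. Assume that $R$ is transitive, antisymmetric and isotone. If $0_G\in B$ and $0_G R b$ for every $b\in B$, then $\mathscr{E}(A+B)=\mathscr{E}(A)$.
   Context: For $x,y\in G$, $xPy$ means that $xRy$ holds and $yRx$ does not. $R$ is antisymmetric if $xRy$ and $yRx$ imply $x=y$. $R$ is isotone if for all $g,g',z\in G$, $gRg'$ implies $(z+g)R(z+g')$ and $(g+z)R(g'+z)$. The sum set is $A+B=\{a+b: a\in A, b\in B\}$. For $S\subseteq G$, $\mathscr{E}(S)$ is the set of efficient points of $S$, i.e. of those $g\in S$ for which there is no $g'\in S$ with $g'Pg$; by convention $\mathscr{E}(\emptyset)=\emptyset$. *)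

(* Defs.v *)
From Stdlib Require Export Relation_Definitions.
From mathcomp Require Export all_boot boolp classical_sets.

Set Implicit Arguments.
Unset Strict Implicit.
Unset Printing Implicit Defensive.

(* MathComp's additive groups ([zmodType]) are all abelian, and its structure
   for possibly non-commutative, possibly infinite groups, [groupType], is
   written multiplicatively: the group law [g + h] is [(g * h)%g] here and the
   identity [0_G] is [1%g].  A [groupType] also carries a choice operator, which
   classically every type has ([boolp.gen_choiceMixin]). *)

Local Open Scope classical_set_scope.
Local Open Scope group_scope.

Definition strict_part (T : Type) (R : relation T) : relation T :=
  fun x y => R x y /\ ~ R y x.

Definition isotone (G : groupType) (R : relation G) : Prop :=
  forall g g' z : G, R g g' -> R (z * g) (z * g') /\ R (g * z) (g' * z).

Definition sumset (G : groupType) (A B : set G) : set G :=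
  [set a * b | a in A & b in B].

Definition efficient (T : Type) (R : relation T) (S : set T) : set T :=
  [set g | S g /\ ~ exists g', S g' /\ strict_part R g' g].

(* Main.v *)
Require Import Defs.

(** Since [1] lies in [B], the set [A] is contained in the sum set.  Since
    [R 1 b] for [b] in [B], isotony gives [R a (a * b)], so each element of the
    sum set is weakly preceded by an element of [A].  Enlarging a set by elements
    that are weakly preceded by old ones does not change its efficient points
    ([efficient_dominating_subset]): a new point cannot be efficient unless it
    coincides with the old point below it, and a new point that beats an old one
    can be replaced by an old point that does so too. *)

Local Open Scope classical_set_scope.
Local Open Scope group_scope.

Lemma strict_part_le_trans (T : Type) (R : relation T) (x y z : T) :
  Relation_Definitions.transitive T R ->
  R x y -> strict_part R y z -> strict_part R x z.
Proof.
move=> R_trans xy [yz nzy]; split; first exact: R_trans xy yz.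
by move=> zx; apply: nzy; exact: R_trans zx xy.
Qed.

(** An efficient point of [S] cannot be strictly preceded by the element of [A]
    below it, so the two are [R]-equivalent and, by antisymmetry, equal.
    Conversely, if [s] in [S] strictly preceded an efficient point of [A], then
    by transitivity so would the element of [A] below [s]. *)
Lemma efficient_dominating_subset (T : Type) (R : relation T) (A S : set T) :
  Relation_Definitions.transitive T R ->
  Relation_Definitions.antisymmetric T R ->
  A `<=` S -> (forall s, S s -> exists2 a, A a & R a s) ->
  efficient R S = efficient R A.
Proof.
move=> R_trans R_antisym AS dom; apply/seteqP; split=> g [Sg g_eff].
- have [a Aa ag] := dom g Sg.
  have ga : R g a.
    by apply: contrapT => nga; apply: g_eff; exists a; split; [exact: AS|].
  have ->: g = a by exact: R_antisym.
  split=> // -[a' [Aa' a'a]]; apply: g_eff; exists a'; split; first exact: AS.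
  by rewrite (R_antisym g a).
- split; first exact: AS.
  move=> [s [Ss sg]]; have [a Aa a_s] := dom s Ss.
  by apply: g_eff; exists a; split=> //; exact: strict_part_le_trans a_s sg.
Qed.

Theorem theorem2 (G : groupType) (R : relation G) (A B : set G)
    (R_refl : Relation_Definitions.reflexive G R)
    (A_nonempty : (A !=set0)%classic) (B_nonempty : (B !=set0)%classic)
    (R_trans : Relation_Definitions.transitive G R)
    (R_antisym : Relation_Definitions.antisymmetric G R)
    (R_isotone : isotone R)
    (B_id : B 1%g) (B_ge_id : forall b : G, B b -> R 1%g b) :
  efficient R (sumset A B) = efficient R A.
Proof.
apply: efficient_dominating_subset => //.
- by move=> a Aa; exists a => //; exists 1 => //; rewrite mulg1.
- move=> _ [a Aa [b Bb <-]]; exists a => //.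
  by have [+ _] := R_isotone _ _ a (B_ge_id b Bb); rewrite mulg1.
Qed.
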